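(* Let $n$ be a positive integer, let $D_n$ be the dihedral group of order $2n$, and let $q$ be an odd positive integer. Then $D_n\otimes^q D_n\cong D_n$ and $H_2(D_n,\mathbb{Z}_q)=\{1\}$.
   Context: Conventions: $x^y=y^{-1}xy$, $[x,y]=x^{-1}y^{-1}xy$. The dihedral group of order $2n$ is $D_n=\langle g_1,g_2\mid g_1^2=1,\ g_1^{-1}g_2g_1=g_2^{n-1},\ g_2^n=1\rangle$. $H_2(D_n,\mathbb{Z}_q)$ is the second homology group of $D_n$ with coefficients in $\mathbb{Z}_q=\mathbb{Z}/q\mathbb{Z}$ (trivial action). For a group $G$ and an integer $q\ge 1$, the $q$-tensor square $G\otimes^q G$ is the group generated by the symbols $g\otimes h$ and $\widehat k$, for $g,h,k\in G$, subject to the relations, for all $g,g_1,h,h_1,k,k_1\in G$: (1) $g\otimes hh_1=(g\otimes h_1)(g^{h_1}\otimes h^{h_1})$; (2) $gg_1\otimes h=(g^{g_1}\otimes h^{g_1})(g_1\otimes h)$; (3) $(g\otimes h)^{\widehat k}=g^{(k^q)}\otimes h^{(k^q)}$; (4) $\widehat{kk_1}=\widehat k\,\prod_{i=1}^{q-1}\bigl(k\otimes(k_1^{-i})^{k^{q-1-i}}\bigr)\,\widehat{k_1}$; (5) $[\widehat k,\widehat{k_1}]=k^q\otimes k_1^q$; (6) $\widehat{[g,h]}=(g\otimes h)^q$. *)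

(* Defs.v *)
From HB Require Import structures.
From mathcomp Require Import all_boot all_algebra.
From mathcomp Require Import boolp finmap.
From mathcomp.multinomials Require monalg.

Set Implicit Arguments.
Unset Strict Implicit.
Unset Printing Implicit Defensive.

Import GRing.Theory.

Local Open Scope group_scope.

(* Formal group expressions in letters X. The baseGroupType structure satisfies
   no laws; it only makes the library operations x * y, x^-1, x ^+ n,
   x ^ y = y^-1 * (x * y) and [~ x, y] = x^-1 * x ^ y available for writing
   defining relations. *)
Inductive gexp (X : Type) : Type :=
  | Letter of X
  | ExpOne
  | ExpMul of gexp X & gexp X
  | ExpInv of gexp X.

Arguments ExpOne {X}.

HB.instance Definition _ (X : Type) := gen_eqMixin (gexp X).
HB.instance Definition _ (X : Type) := gen_choiceMixin (gexp X).
HB.instance Definition _ (X : Type) := hasMul.Build (gexp X) (@ExpMul X).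
HB.instance Definition _ (X : Type) := hasOne.Build (gexp X) (@ExpOne X).
HB.instance Definition _ (X : Type) := hasInv.Build (gexp X) (@ExpInv X).

(* presented R below is the group < X | u = v whenever R u v >. *)
Inductive gcong (X : Type) (R : gexp X -> gexp X -> Prop) :
    gexp X -> gexp X -> Prop :=
  | gcong_rel u v : R u v -> gcong R u v
  | gcong_refl u : gcong R u u
  | gcong_sym u v : gcong R u v -> gcong R v u
  | gcong_trans u v w : gcong R u v -> gcong R v w -> gcong R u w
  | gcong_mul u u' v v' :
      gcong R u u' -> gcong R v v' -> gcong R (u * v) (u' * v')
  | gcong_inv u u' : gcong R u u' -> gcong R u^-1 u'^-1
  | gcong_mulA u v w : gcong R (u * (v * w)) (u * v * w)
  | gcong_mul1g u : gcong R (1 * u) u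
  | gcong_mulg1 u : gcong R (u * 1) u
  | gcong_mulVg u : gcong R (u^-1 * u) 1
  | gcong_mulgV u : gcong R (u * u^-1) 1.

Section Presented.
Variables (X : Type) (R : gexp X -> gexp X -> Prop).

Definition gcongb (u v : gexp X) : bool := `[< gcong R u v >].

Lemma gcongb_equiv : equiv_class_of gcongb.
Proof.
split=> [u|u v|v u w].
- by apply/asboolP; exact: gcong_refl.
- by apply/asboolP/asboolP; exact: gcong_sym.
- by move=> /asboolP uv /asboolP vw; apply/asboolP; exact: gcong_trans vw.
Qed.

Canonical gcongb_equivRel := EquivRelPack gcongb_equiv.

Definition presented : Type := {eq_quot gcongb}%qT.

HB.instance Definition _ := EqQuotient.on presented.
HB.instance Definition _ := gen_choiceMixin presented.

Local Notation pi := (\pi_presented)%qT.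

Lemma presented_eqP (u v : gexp X) : reflect (gcong R u v) (pi u == pi v).
Proof. by rewrite eqmodE; exact: asboolP. Qed.

Definition presented_mul (x y : presented) : presented := pi (repr x * repr y).
Definition presented_inv (x : presented) : presented := pi (repr x)^-1.
Local Notation pmul := presented_mul.
Local Notation pinv := presented_inv.

Let gcong_repr u : gcong R (repr (pi u)) u.
Proof. by apply/presented_eqP; rewrite reprK eqxx. Qed.

Let pmulE u v : pmul (pi u) (pi v) = pi (u * v).
Proof. by apply/eqP/presented_eqP; apply: gcong_mul; exact: gcong_repr. Qed.

Let pinvE u : pinv (pi u) = pi u^-1.
Proof. by apply/eqP/presented_eqP; apply: gcong_inv; exact: gcong_repr. Qed.

Let pmulA : associative pmul.
Proof.
elim/quotW=> u; elim/quotW=> v; elim/quotW=> w.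
rewrite (pmulE v w) (pmulE u v) !pmulE.
by apply/eqP/presented_eqP; exact: gcong_mulA.
Qed.

Let pmul1g : left_id (pi 1) pmul.
Proof.
by elim/quotW=> u; rewrite pmulE; apply/eqP/presented_eqP; exact: gcong_mul1g.
Qed.

Let pmulg1 : right_id (pi 1) pmul.
Proof.
by elim/quotW=> u; rewrite pmulE; apply/eqP/presented_eqP; exact: gcong_mulg1.
Qed.

Let pmulVg : left_inverse (pi 1) pinv pmul.
Proof.
by elim/quotW=> u; rewrite pinvE pmulE; apply/eqP/presented_eqP; exact: gcong_mulVg.
Qed.

Let pmulgV : right_inverse (pi 1) pinv pmul.
Proof.
by elim/quotW=> u; rewrite pinvE pmulE; apply/eqP/presented_eqP; exact: gcong_mulgV.
Qed.

HB.instance Definition _ :=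
  isGroup.Build presented pmulA pmul1g pmulg1 pmulVg pmulgV.

Lemma presentedM u v : pi (u * v) = pi u * pi v. Proof. by rewrite -pmulE. Qed.
Lemma presentedV u : pi u^-1 = (pi u)^-1. Proof. by rewrite -pinvE. Qed.
Lemma presented1 : pi 1 = 1. Proof. by []. Qed.

Lemma presented_rel u v : R u v -> pi u = pi v.
Proof. by move=> Ruv; apply/eqP/presented_eqP; exact: gcong_rel. Qed.

Fixpoint gexp_eval (G : groupType) (f : X -> G) (u : gexp X) : G :=
  match u with
  | Letter x => f x
  | ExpOne => 1
  | ExpMul u v => gexp_eval f u * gexp_eval f v
  | ExpInv u => (gexp_eval f u)^-1
  end.

Lemma presented_lift (G : groupType) (f : X -> G) :
    (forall u v, R u v -> gexp_eval f u = gexp_eval f v) ->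
  exists F : {multiplicative presented -> G},
    forall x, F (pi (Letter x)) = f x.
Proof.
move=> fR.
have fP u v : gcong R u v -> gexp_eval f u = gexp_eval f v.
  elim=> {u v} //=; try by move=> *; congruence.
  - by move=> u v w; rewrite mulgA.
  - by move=> u; rewrite mul1g.
  - by move=> u; rewrite mulg1.
  - by move=> u; rewrite mulVg.
  - by move=> u; rewrite mulgV.
pose F (x : presented) := gexp_eval f (repr x).
have FE u : F (pi u) = gexp_eval f u by apply: fP; exact: gcong_repr.
have FM : {morph F : x y / x * y}.
  elim/quotW=> u; elim/quotW=> v.
  by rewrite -(presentedM u v) (FE (u * v)) (FE u) (FE v).
pose FM' := isMultiplicative.Build _ _ F FM.
pose F' : {multiplicative presented -> G} := HB.pack F FM'.
by exists F' => x; exact: FE.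
Qed.

End Presented.

Definition group_iso (G H : groupType) : Prop :=
  exists f : {multiplicative G -> H}, bijective f.

Inductive dihedral_letter : Type := Dih1 | Dih2.

Section Dihedral.
Variable n : nat.

Let g1 : gexp dihedral_letter := Letter Dih1.
Let g2 : gexp dihedral_letter := Letter Dih2.

(* MathComp's 'D_m is only meant for m >= 4, which would exclude n = 1. *)
Inductive dihedral_rel : gexp dihedral_letter -> gexp dihedral_letter -> Prop :=
  | dihedral_rel1 : dihedral_rel (g1 ^+ 2) 1
  | dihedral_rel2 : dihedral_rel (g1^-1 * g2 * g1) (g2 ^+ (n - 1))
  | dihedral_rel3 : dihedral_rel (g2 ^+ n) 1.

Definition dihedral : groupType := presented dihedral_rel.

End Dihedral.

Inductive qtensor_letter (G : Type) : Type :=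
  | Tensor of G & G
  | Hat of G.

Section QTensor.
Variables (q : nat) (G : groupType).

Let tens (g h : G) : gexp (qtensor_letter G) := Letter (Tensor g h).
Let hat (k : G) : gexp (qtensor_letter G) := Letter (Hat k).

Inductive qtensor_rel :
    gexp (qtensor_letter G) -> gexp (qtensor_letter G) -> Prop :=
  | qtensor_rel1 g h h1 :
      qtensor_rel (tens g (h * h1)) (tens g h1 * tens (g ^ h1) (h ^ h1))
  | qtensor_rel2 g g1 h :
      qtensor_rel (tens (g * g1) h) (tens (g ^ g1) (h ^ g1) * tens g1 h)
  | qtensor_rel3 g h k :
      qtensor_rel (tens g h ^ hat k) (tens (g ^ (k ^+ q)) (h ^ (k ^+ q)))
  | qtensor_rel4 k k1 :
      qtensor_rel (hat (k * k1))
        (hat k *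
         (\prod_(1 <= i < q) tens k ((k1 ^- i) ^ (k ^+ (q - 1 - i)))) *
         hat k1)
  | qtensor_rel5 k k1 :
      qtensor_rel [~ hat k, hat k1] (tens (k ^+ q) (k1 ^+ q))
  | qtensor_rel6 g h :
      qtensor_rel (hat [~ g, h]) (tens g h ^+ q).

Definition qtensor_square : groupType := presented qtensor_rel.

End QTensor.

(* H2 G A is H_2(G, A) for the trivial action of G on A. It is the homology of
   A (x) (bar resolution), whose term in degree i is the group A[G^i] of finitely
   supported functions G^i -> A, with << a *g (g, h) >> standing for a[g|h]. *)
Import monalg.

Section Homology.
Variables (G : groupType) (A : zmodType).

Local Open Scope ring_scope.

Local Notation chain K := {malg A[K%type]}.

Definition chain_lift (K : choiceType) (V : zmodType) (f : A -> K -> V)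
  (c : {malg A[K]}) : V := \sum_(k <- msupp c) f c@_k k.

Lemma chain_liftB (K : choiceType) (V : zmodType) (f : A -> K -> V) :
  (forall k, zmod_morphism (f^~ k)) -> zmod_morphism (chain_lift f).
Proof.
move=> fB.
have f0 k : f 0 k = 0 by rewrite -[X in f X k](subrr 0) fB subrr.
have chain_liftE (D : {fset K}) (c : {malg A[K]}) :
    (msupp c `<=` D)%fset -> chain_lift f c = \sum_(k <- D) f c@_k k.
  move=> cD; rewrite /chain_lift (big_fset_incl _ cD) // => k _ kNc.
  by rewrite mcoeff_outdom.
move=> c c'; pose D := (msupp c `|` msupp c')%fset.
rewrite (chain_liftE D) ?msuppB_le // (chain_liftE D) ?fsubsetUl //.
rewrite (chain_liftE D) ?fsubsetUr // -sumrB.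
by apply: eq_bigr => k _; rewrite mcoeffB fB.
Qed.

Lemma chain_liftU (K : choiceType) (V : zmodType) (f : A -> K -> V) a k :
  f 0 k = 0 -> chain_lift f << a *g k >> = f a k.
Proof.
move=> f0; rewrite /chain_lift msuppU; case: eqP => [->|_].
  by rewrite f0 big_seq_fset0.
by rewrite big_seq_fset1 mcoeffUU.
Qed.

Definition bar2 : chain (G * G) -> chain G :=
  chain_lift (fun a '(g, h) =>
    << a *g h >> - << a *g (g * h)%g >> + << a *g g >>).

Definition bar3 : chain (G * G * G) -> chain (G * G) :=
  chain_lift (fun a '(g, h, k) =>
    << a *g (h, k) >> - << a *g ((g * h)%g, k) >>
    + << a *g (g, (h * k)%g) >> - << a *g (g, h) >>).

Let subDD (V : zmodType) (x y z t : V) :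
  (x - z) + (y - t) = (x + y) - (z + t).
Proof. by rewrite opprD addrACA. Qed.

Let subBB (V : zmodType) (x y z t : V) :
  (x - z) - (y - t) = (x - y) - (z - t).
Proof. by rewrite (opprD y) subDD. Qed.

Let alt3B (V : zmodType) (x y z x' y' z' : V) :
  (x - x') - (y - y') + (z - z') = (x - y + z) - (x' - y' + z').
Proof. by rewrite subBB subDD. Qed.

Let alt4B (V : zmodType) (x y z t x' y' z' t' : V) :
  (x - x') - (y - y') + (z - z') - (t - t') =
  (x - y + z - t) - (x' - y' + z' - t').
Proof. by rewrite alt3B subBB. Qed.

Lemma bar2B : zmod_morphism bar2.
Proof.
by apply: chain_liftB => -[g h] a b; rewrite !monalgUB; exact: alt3B.
Qed.

Lemma bar3B : zmod_morphism bar3.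
Proof.
by apply: chain_liftB => -[[g h] k] a b; rewrite !monalgUB; exact: alt4B.
Qed.

HB.instance Definition _ := GRing.isZmodMorphism.Build _ _ bar2 bar2B.
HB.instance Definition _ := GRing.isZmodMorphism.Build _ _ bar3 bar3B.

Lemma bar2U a g h :
  bar2 << a *g (g, h) >> = << a *g h >> - << a *g (g * h)%g >> + << a *g g >>.
Proof. by apply: chain_liftU; rewrite !monalgU0 subr0 addr0. Qed.

Lemma bar3U a g h k :
  bar3 << a *g (g, h, k) >> =
    << a *g (h, k) >> - << a *g ((g * h)%g, k) >>
    + << a *g (g, (h * k)%g) >> - << a *g (g, h) >>.
Proof. by apply: chain_liftU; rewrite !monalgU0 !subr0 addr0. Qed.

Let alt6 (V : zmodType) (x y z t u v : V) :
  (x - y + z) - (x - t + u) + (y - t + v) - (z - u + v) = 0.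
Proof.
have E (a b c : V) : a - b + c = a + (c - b) by rewrite -addrA (addrC (- b)).
rewrite (E x y z) (E x t u) (addrC x (z - y)) addrKA.
by rewrite addrA (addrAC (z - y)) subrKA opprB subrKA subrr.
Qed.

Lemma bar2_bar3 (c : chain (G * G * G)) : bar2 (bar3 c) = 0.
Proof.
have D : {morph bar2 : x y / x + y} by exact: raddfD.
have mono a g h k : bar2 (bar3 << a *g (g, h, k) >>) = 0.
  rewrite bar3U !(bar2B, D) !bar2U mulgA.
  exact: alt6.
rewrite (monalgE c) (raddf_sum bar3) (raddf_sum bar2) big1_seq //.
by move=> -[[g h] k] _; exact: mono.
Qed.

Definition cycle2_pred : {pred chain (G * G)} := [pred c | bar2 c == 0].

Lemma cycle2_zmod_closed : zmod_closed cycle2_pred.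
Proof.
split=> [|c c' /eqP c0 /eqP c'0]; apply/eqP; first exact: raddf0.
by rewrite bar2B c0 c'0 subr0.
Qed.

HB.instance Definition _ :=
  GRing.isZmodClosed.Build _ cycle2_pred cycle2_zmod_closed.

Record cycle2 := Cycle2 { cycle2_val :> chain (G * G);
                          cycle2P : cycle2_val \in cycle2_pred }.

HB.instance Definition _ := [isSub for cycle2_val].
HB.instance Definition _ := [Choice of cycle2 by <:].
HB.instance Definition _ := [SubChoice_isSubZmodule of cycle2 by <:].

Definition boundary2 : {pred cycle2} :=
  [pred c : cycle2 | `[< exists b, bar3 b = c >]].

Lemma boundary2_zmod_closed : zmod_closed boundary2.
Proof.
split=> [|c c' /asboolP[b bc] /asboolP[b' b'c']]; apply/asboolP.
  by exists 0; rewrite [LHS]raddf0.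
by exists (b - b'); rewrite bar3B bc b'c'.
Qed.

HB.instance Definition _ :=
  GRing.isZmodClosed.Build _ boundary2 boundary2_zmod_closed.

Definition H2 : zmodType := Quotient.quot boundary2.

End Homology.

(* Unlike 'Z_q, this is the trivial group when q = 1. *)
Definition Zmod (q : nat) : zmodType := 'I_q.-1.+1.

(* Main.v *)
(* For q odd, every involution s of a group G gives an involution hat s of the
   q-tensor square, and hat s ^ hat t = hat (s ^ t) for involutions s and t. In
   the dihedral group, where s_i = g1 g2^i, this forces the images of the
   reflections to satisfy the dihedral relations, and these images generate. The
   resulting homomorphism is inverse to the map sending g (x) h to [g, h] and
   hat k to k^q.

   For the homology, sending (g, h) to the class of 1[g|h] gives a 2-cocycle with
   values in the cokernel M of bar3. In the central extension of the dihedral group by M it defines, every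
   involution has a unique involutive lift, because M is killed by the odd q.
   Uniqueness makes the lifts compatible with conjugation, so that the extension
   splits as above, the cocycle is a coboundary, and all 2-cycles are boundaries. *)
From HB Require Import structures.
Require Import Defs.
From mathcomp Require Import all_boot all_algebra.
From mathcomp Require Import boolp.
From mathcomp.multinomials Require monalg.

Set Implicit Arguments.
Unset Strict Implicit.
Unset Printing Implicit Defensive.

Import GRing.Theory.

Local Open Scope group_scope.

(** * Multiplicative maps between groups *)

Section GroupMorphism.
Variables (G H : groupType) (f : {multiplicative G -> H}).

Lemma mult1 : f 1 = 1.
Proof. by apply: (mulgI (f 1)); rewrite -gmulfM !mulg1. Qed.

(** Cancellation makes a product-preserving map of groups unital; in this packed form the library
    lemmas on powers, inverses and commutators apply to it. *)
Definition multU : UMagmaMorphism.type G H :=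
  HB.pack (f : G -> H) (isMultiplicative.Build G H f (@gmulfM _ _ f))
    (Multiplicative_isUMagmaMorphism.Build G H f mult1).

Lemma multX x n : f (x ^+ n) = f x ^+ n.
Proof. exact: (gmulfXn multU). Qed.

Lemma multR x y : f [~ x, y] = [~ f x, f y].
Proof. exact: (gmulfR multU). Qed.

Lemma multV x : f x^-1 = (f x)^-1.
Proof. exact: (gmulfV multU). Qed.

End GroupMorphism.

(** * Generators, induction and evaluation in presented groups *)

Section Presented.
Variables (X : Type) (R : gexp X -> gexp X -> Prop).

Definition gen (x : X) : presented R := (\pi_(presented R) (Letter x))%qT.

Lemma presented_piE (u : gexp X) : (\pi_(presented R) u)%qT = gexp_eval gen u.
Proof.
elim: u => [x||u IHu v IHv|u IHu] //=.
  by rewrite -IHu -IHv -presentedM.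
by rewrite -IHu -presentedV.
Qed.

Lemma presented_relE (u v : gexp X) : R u v -> gexp_eval gen u = gexp_eval gen v.
Proof. by rewrite -!presented_piE; exact: presented_rel. Qed.

Lemma presented_ind (P : presented R -> Prop) :
    P 1 -> (forall x y, P x -> P y -> P (x * y)) ->
    (forall x, P x -> P x^-1) -> (forall x, P (gen x)) ->
  forall x, P x.
Proof.
move=> P1 PM PV Pg; elim/quotW => u; rewrite presented_piE.
by elim: u => //= [u IHu v IHv|u IHu]; [exact: PM | exact: PV].
Qed.

Lemma presented_mult_eq (G : groupType) (f g : {multiplicative presented R -> G}) :
  (forall x, f (gen x) = g (gen x)) -> f =1 g.
Proof.
move=> fg; apply: presented_ind => //= [|x y|x]; first by rewrite !mult1.
  by rewrite !gmulfM => -> ->.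
by rewrite !multV => ->.
Qed.

End Presented.

Section Eval.
Variables (X : Type) (G : groupType) (f : X -> G).

Lemma gexp_evalX u n : gexp_eval f (u ^+ n) = gexp_eval f u ^+ n.
Proof.
case: n => // n; elim: n => [|n IH] //.
by rewrite expgSS [LHS]/= IH expgSS.
Qed.

Lemma gexp_eval_prod (I : Type) (r : seq I) (P : pred I) (F : I -> gexp X) :
  gexp_eval f (\prod_(i <- r | P i) F i) = \prod_(i <- r | P i) gexp_eval f (F i).
Proof. exact: (big_morph (gexp_eval f)). Qed.

End Eval.

(** * Reflections in the dihedral group *)

Section Dihedral.
Variable n : nat.

Local Notation g1 := (gen (dihedral_rel n) Dih1).
Local Notation g2 := (gen (dihedral_rel n) Dih2).

Lemma dihedral_gen1 : g1 * g1 = 1 :> dihedral n.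
Proof. exact: (presented_relE (dihedral_rel1 n)). Qed.

Lemma dihedral_gen2 : g2 ^+ n = 1 :> dihedral n.
Proof. by have := presented_relE (dihedral_rel3 n); rewrite gexp_evalX. Qed.

Hypothesis n_gt0 : 0 < n.

Lemma dihedral_conj : g2 ^ g1 = g2^-1 :> dihedral n.
Proof.
have := presented_relE (dihedral_rel2 n); rewrite gexp_evalX /= -mulgA.
rewrite conjgE => ->; apply: (mulIg g2).
by rewrite -expgSr subn1 prednK // mulVg dihedral_gen2.
Qed.

Definition refl i : dihedral n := g1 * g2 ^+ i.

Lemma dihedral_swap i : g2 ^+ i * g1 = g1 * g2 ^- i :> dihedral n.
Proof. by rewrite conjgC conjXg dihedral_conj expVgn. Qed.

Lemma refl_invol i : refl i * refl i = 1.
Proof.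
rewrite /refl mulgA -(mulgA g1) dihedral_swap mulgA dihedral_gen1 mul1g.
exact: mulVg.
Qed.

Lemma refl_mul i j : refl i * refl (i + j) = g2 ^+ j.
Proof.
rewrite /refl mulgA -(mulgA g1) dihedral_swap mulgA dihedral_gen1 mul1g.
by rewrite expgnDr mulKg.
Qed.

Lemma refl_conj i : refl i ^ refl i.+1 = refl i.+2.
Proof.
have := refl_mul i 1; rewrite addn1 conjgE (mulg1_eq (refl_invol _)) => ->.
by rewrite /refl -mulgA -expgSr.
Qed.

Lemma refl0 : refl 0 = g1. Proof. by rewrite /refl expg0 mulg1. Qed.

Lemma refl_period : refl n = refl 0.
Proof. by rewrite /refl dihedral_gen2. Qed.

Lemma refl_conj_refl i j : exists k, refl i ^ refl j = refl k.
Proof.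
(* With k = j + n i one has s_j = s_k and s_k s_i s_k = s_k g2^(k - i). Adding n i ensures k >= i,
   so that the subtraction is not truncated. *)
exists (j + n * i + (j + n * i - i)).
have -> : refl j = refl (j + n * i).
  by rewrite /refl expgnDr expgnA dihedral_gen2 expg1n mulg1.
set k := j + n * i; have le_ik : i <= k.
  by rewrite (leq_trans _ (leq_addl _ _)) // leq_pmull.
rewrite conjgE (mulg1_eq (refl_invol _)) -{2}(subnKC le_ik) refl_mul.
by rewrite /refl -mulgA -expgnDr.
Qed.

(** Rotations and reflections together are stable under left multiplication by the generators and
    their inverses, and g2^i = s_0 s_i. Identities can thus be reduced to reflections. *)
Lemma dihedral_elem (x : dihedral n) :
  (exists i, x = refl i) \/ exists i j, x = refl i * refl j.
Proof.
pose S (x : dihedral n) := exists i, x = refl i \/ x = g2 ^+ i.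
have g2V : g2^-1 = g2 ^+ n.-1.
  by apply: (mulIg g2); rewrite mulVg -expgSr prednK // dihedral_gen2.
have S1 y : S y -> S (g1 * y).
  case=> i [] ->; exists i; [right | by left].
  by rewrite /refl mulgA dihedral_gen1 mul1g.
have S2X k y : S y -> S (g2 ^+ k * y).
  case=> i [] ->; last by exists (k + i); right; rewrite expgnDr.
  exists (n.-1 * k + i); left.
  by rewrite /refl mulgA dihedral_swap -mulgA -expVgn g2V -expgnA -expgnDr.
(* Treating [x] and [x^-1] together lets the induction pass through inverses. *)
have [Sx _] : (forall y, S y -> S (x * y)) /\ (forall y, S y -> S (x^-1 * y)).
  elim/presented_ind: x => [|x y [Sx SxV] [Sy SyV]|x [Sx SxV]|[]].
  - by rewrite invg1; split=> y; rewrite mul1g.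
  - by rewrite invgM; split=> z ?; rewrite -mulgA; auto.
  - by rewrite invgK.
  - by rewrite (mulg1_eq dihedral_gen1).
  - by split=> y; [exact: (S2X 1%N) | rewrite g2V; exact: S2X].
have [|i [] xE] := Sx 1; first by exists 0; right.
  by left; exists i; rewrite -xE mulg1.
by right; exists 0, i; rewrite (refl_mul 0) -xE mulg1.
Qed.

(* The images of consecutive reflections have a constant product, because
   refl i ^ refl i.+1 = refl i.+2; this product is the image of g2. *)
Lemma dihedral_lift (E : groupType) (u : dihedral n -> E) :
    (forall s, s * s = 1 -> u s * u s = 1) ->
    (forall s t, s * s = 1 -> t * t = 1 -> u s ^ u t = u (s ^ t)) ->
  exists F : {multiplicative dihedral n -> E}, forall i, F (refl i) = u (refl i).
Proof.
move=> u2 uJ; have u2i i := u2 _ (refl_invol i).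
have uV i : (u (refl i))^-1 = u (refl i) by exact: mulg1_eq.
pose a := u (refl 0); pose b := a * u (refl 1).
have bE i : u (refl i) * u (refl i.+1) = b.
  elim: i => [|i <-] //.
  by rewrite [RHS]conjgC uJ ?refl_invol // refl_conj.
have uE i : u (refl i) = a * b ^+ i.
  elim: i => [|i IH]; first by rewrite mulg1.
  by rewrite expgSr mulgA -IH -(bE i) mulgA u2i mul1g.
have bn : b ^+ n = 1 by apply: (mulgI a); rewrite mulg1 -uE refl_period.
have bJ : b ^ a = b^-1.
  have aV : a^-1 = a := uV 0.
  have aa : a * a = 1 := u2i 0.
  by rewrite conjgE aV /b invgM aV uV !mulgA aa mul1g.
pose f x := if x is Dih1 then a else b.
have [|F FE] := @presented_lift _ (dihedral_rel n) E f.
  move=> _ _ []; rewrite ?gexp_evalX //=.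
  - by rewrite /a expg2.
  - rewrite -mulgA -conjgE bJ; apply: (mulIg b).
    by rewrite mulVg -expgSr subn1 prednK.
exists F => i; rewrite uE gmulfM multX.
by rewrite (FE Dih1) (FE Dih2).
Qed.

End Dihedral.

(** * Commutator identities and involutions *)

Section GroupIdentities.
Variable G : groupType.
Implicit Types x y s : G.

Lemma expg_rot x y p : (x * y) ^+ p.+1 = x * (y * x) ^+ p * y.
Proof.
elim: p => [|p IH]; first by rewrite !mulg1.
by rewrite expgS IH [in RHS]expgS !mulgA.
Qed.

Lemma commgMr x y z : [~ x, y * z] = [~ x, z] * [~ x ^ z, y ^ z].
Proof. by rewrite -conjRg !commgEl !conjgE !gnorm. Qed.

Lemma commgMl x y z : [~ x * y, z] = [~ x ^ y, z ^ y] * [~ y, z].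
Proof. by rewrite -conjRg !commgEl !conjgE !gnorm. Qed.

(* With p = q - 1 the product over the first m indices telescopes to
   x^-p (y x)^m y^-m x^(p - m). *)
Lemma expgM_commg x y q : 0 < q ->
  (x * y) ^+ q =
  x ^+ q * (\prod_(1 <= i < q) [~ x, (y ^- i) ^ (x ^+ (q - 1 - i))]) * y ^+ q.
Proof.
case: q => // p _; rewrite subn1 /=.
have tele m : m <= p ->
    \prod_(1 <= i < m.+1) [~ x, (y ^- i) ^ (x ^+ (p - i))] =
    x ^- p * ((y * x) ^+ m * (y ^- m * x ^+ (p - m))).
  elim: m => [_|m IH lt_mp].
    by rewrite big_geq // subn0 expg0 invg1 !mul1g mulVg.
  rewrite big_nat_recr //= IH 1?ltnW // -(subnSK lt_mp).
  set k := p - m.+1.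
  have xk : x ^ (x ^+ k) = x by apply/conjg_fixP/eqP/commgXg.
  rewrite -[X in [~ X, _]]xk -conjRg (expgSr (y * x)) -!mulgA; do 2 congr (_ * _).
  by rewrite commgEl !conjgE (expgS x) (expgSr y) !gnorm.
rewrite tele // subnn expg0 mulg1 expg_rot (expgS x) (expgSr y).
by rewrite !mulgA mulgK mulgVK.
Qed.

Lemma conjgg x : x ^ x = x.
Proof. by rewrite conjgE mulKg. Qed.

Lemma involX s i : s * s = 1 -> s ^+ i = if odd i then s else 1.
Proof.
move=> s2; elim: i => [|i IH] //=.
by rewrite expgS IH; case: odd; rewrite /= ?mulg1.
Qed.

Lemma involJ s x : s * s = 1 -> s ^ x * s ^ x = 1.
Proof. by move=> s2; rewrite -conjMg s2 conj1g. Qed.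

End GroupIdentities.

(** * Involutions in the q-tensor square *)

Section QTensor.
Variables (q : nat) (G : groupType).
Implicit Types g h k s t : G.

Local Notation T := (qtensor_square q G).

Definition tens g h : T := gen (qtensor_rel q (G:=G)) (Tensor g h).
Definition hat k : T := gen (qtensor_rel q (G:=G)) (Hat k).

Lemma tensMr g h h1 : tens g (h * h1) = tens g h1 * tens (g ^ h1) (h ^ h1).
Proof. exact: (presented_relE (qtensor_rel1 q g h h1)). Qed.

Lemma tensMl g g1 h : tens (g * g1) h = tens (g ^ g1) (h ^ g1) * tens g1 h.
Proof. exact: (presented_relE (qtensor_rel2 q g g1 h)). Qed.

Lemma tensJhat g h k : tens g h ^ hat k = tens (g ^ (k ^+ q)) (h ^ (k ^+ q)).
Proof. exact: (presented_relE (qtensor_rel3 q g h k)). Qed.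

Lemma hatM k k1 : hat (k * k1) =
  hat k * (\prod_(1 <= i < q) tens k ((k1 ^- i) ^ (k ^+ (q - 1 - i)))) * hat k1.
Proof.
have := presented_relE (qtensor_rel4 q k k1).
by rewrite /= gexp_eval_prod.
Qed.

Lemma hatR k k1 : [~ hat k, hat k1] = tens (k ^+ q) (k1 ^+ q).
Proof. exact: (presented_relE (qtensor_rel5 q k k1)). Qed.

Lemma tensg1 g : tens g 1 = 1.
Proof.
by apply: (mulgI (tens g 1)); rewrite mulg1 -[in RHS](mulg1 1) tensMr !conjg1.
Qed.

Lemma tens1g g : tens 1 g = 1.
Proof.
by apply: (mulgI (tens 1 g)); rewrite mulg1 -[in RHS](mulg1 1) tensMl !conjg1.
Qed.

Lemma hat1 : hat 1 = 1.
Proof.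
apply: (mulgI (hat 1)); rewrite mulg1 -[in RHS](mulg1 1) hatM big1 ?mulg1 //.
by move=> i _; rewrite tens1g.
Qed.

(** Commutators and q-th powers satisfy the six defining relations; the fourth is [expgM_commg]. *)
Lemma qtensor_comm : 0 < q -> exists F : {multiplicative T -> G},
  (forall g h, F (tens g h) = [~ g, h]) /\ (forall k, F (hat k) = k ^+ q).
Proof.
move=> q_gt0.
pose f (x : qtensor_letter G) :=
  match x with Tensor g h => [~ g, h] | Hat k => k ^+ q end.
have [|F FE] := @presented_lift _ (qtensor_rel q (G:=G)) G f.
  move=> _ _ [g h h1|g g1 h|g h k|k k1|k k1|g h] //=.
  - exact: commgMr.
  - exact: commgMl.
  - exact: conjRg.
  - by rewrite gexp_eval_prod expgM_commg.
  - by rewrite gexp_evalX.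
by exists F; split=> *; rewrite FE.
Qed.

Hypothesis q_odd : odd q.

Let half_odd : q = q./2.*2.+1.
Proof. by rewrite -add1n -[in LHS](odd_double_half q) q_odd. Qed.

Lemma hatR_invol s t : s * s = 1 -> t * t = 1 -> [~ hat s, hat t] = tens s t.
Proof. by move=> s2 t2; rewrite hatR !involX // q_odd. Qed.

Lemma tensJ_invol g h s : s * s = 1 -> tens g h ^ hat s = tens (g ^ s) (h ^ s).
Proof. by move=> s2; rewrite tensJhat !involX // q_odd. Qed.

(** Expand [hat (s * s)] by the fourth relation: each inner factor is [tens s 1] or [tens s s], and
    the latter is the commutator of [hat s] with itself. *)
Lemma hat_invol s : s * s = 1 -> hat s * hat s = 1.
Proof.
move=> s2; rewrite -hat1 -s2 hatM big1 ?mulg1 // => i _.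
have -> : s ^- i ^ s ^+ (q - 1 - i) = s ^+ i.
  rewrite -expVgn (mulg1_eq s2); apply/conjg_fixP/commgP.
  exact: commuteX2.
rewrite involX //; case: ifP => _; last exact: tensg1.
by rewrite -hatR_invol // commgg.
Qed.

Lemma hatV_invol s : s * s = 1 -> (hat s)^-1 = hat s.
Proof. by move=> s2; apply: mulg1_eq; exact: hat_invol. Qed.

(** As q is odd, i and q - 1 - i have the same parity. So in the fourth relation the factors with i
    even vanish, and each of the (q - 1)/2 others is [tens s (t ^ s)], which equals [w]. The product
    [hat s * (hat t * hat s) ^+ (q - 1) * hat t] is then a q-th power. *)
Lemma hatM_invol s t : s * s = 1 -> t * t = 1 ->
  hat (s * t) = (hat s * hat t) ^+ q.
Proof.
move=> s2 t2; pose w := (hat t * hat s) ^+ 2.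
have wE : tens s (t ^ s) = w.
  rewrite -[X in tens X _](conjgg s) -tensJ_invol // -hatR_invol //.
  rewrite commgEl !conjgE !hatV_invol // !mulgA hat_invol // mul1g.
  by rewrite /w expg2 !mulgA.
have prodE m : \prod_(1 <= i < m.*2.+1) (if odd i then w else 1) = w ^+ m.
  elim: m => [|m IH]; first by rewrite big_geq.
  by rewrite doubleS 2?big_nat_recr //= IH odd_double mulg1 expgSr.
rewrite hatM (eq_big_nat _ _ (F2 := fun i => if odd i then w else 1)).
  rewrite [X in index_iota _ X]half_odd prodE [X in (hat s * hat t) ^+ X]half_odd.
  by rewrite expg_rot /w -expgnA mul2n.
move=> i /andP[i_gt0 lt_iq].
have odd_i : odd (q - 1 - i) = odd i.
  by rewrite -subnDA add1n oddB //= q_odd /= negbK.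
rewrite -expVgn (mulg1_eq t2) !involX // odd_i.
by case: odd; rewrite ?wE // conj1g tensg1.
Qed.

(* The products hat s * hat t and hat t * hat (s ^ t) have equal q-th powers (both
   are hat (s * t)) and equal squares (both are tens s t), and q is odd. *)
Lemma hatJ_invol s t : s * s = 1 -> t * t = 1 -> hat s ^ hat t = hat (s ^ t).
Proof.
move=> s2 t2; have st2 := involJ t s2.
suff xy : hat s * hat t = hat t * hat (s ^ t) by rewrite conjgE xy mulKg.
have sq (a b : G) : a * a = 1 -> b * b = 1 -> (hat a * hat b) ^+ 2 = tens a b.
  by move=> ? ?; rewrite -hatR_invol // commgEl conjgE !hatV_invol // expg2 !mulgA.
have E2 : (hat s * hat t) ^+ 2 = (hat t * hat (s ^ t)) ^+ 2.
  rewrite [RHS]sq // -[X in tens X _](conjgg t) -tensJ_invol // -sq //.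
  by rewrite conjXg conjgE hatV_invol // !mulgA hat_invol // mul1g.
have Eq : (hat s * hat t) ^+ q = (hat t * hat (s ^ t)) ^+ q.
  by rewrite -!hatM_invol // -conjgC.
move: Eq; have expgq (z : T) : z ^+ q = (z ^+ 2) ^+ q./2 * z.
  by rewrite [X in _ ^+ X]half_odd expgSr -mul2n expgnA.
by rewrite !expgq E2 => /mulgI.
Qed.

End QTensor.

(** * The q-tensor square of the dihedral group *)

Lemma qtensor_dihedral n q : 0 < n -> odd q ->
  group_iso (qtensor_square q (dihedral n)) (dihedral n).
Proof.
move=> n_gt0 q_odd.
have [F [FT FH]] := qtensor_comm (dihedral n) (odd_gt0 q_odd).
have [P PE] := dihedral_lift n_gt0 (@hat_invol q (dihedral n) q_odd) (hatJ_invol q_odd).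
have refl_conjR i j := refl_conj_refl n_gt0 i j.
have rV i := refl_invol n_gt0 i.
have hatX i : hat q (refl n i) ^+ q = hat q (refl n i).
  by rewrite involX ?q_odd //; exact: hat_invol.
(* On reflections this is [hatR_invol]. Commutators and tensors expand products by the same rule,
   and conjugation permutes the reflections, so products of two reflections follow in each
   argument. *)
have PR g h : P [~ g, h] = tens q g h.
  have ref_ref i j : P [~ refl n i, refl n j] = tens q (refl n i) (refl n j).
    by rewrite multR !PE hatR_invol //; exact: rV.
  have ref_any i k : P [~ refl n i, k] = tens q (refl n i) k.
    case: (dihedral_elem n_gt0 k) => [[j ->]|[j [l ->]]] //.
    rewrite commgMr tensMr gmulfM ref_ref.
    by have [a ->] := refl_conjR i l; have [b ->] := refl_conjR j l; rewrite ref_ref.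
  case: (dihedral_elem n_gt0 g) => [[i ->]|[i [j ->]]] //.
  rewrite commgMl tensMl gmulfM ref_any.
  by have [a ->] := refl_conjR i j; rewrite ref_any.
exists F, P.
  pose PF : {multiplicative _ -> _} := P \o F.
  apply: (@presented_mult_eq _ _ _ PF idfun) => -[g h|k] /=.
    by rewrite FT PR.
  (* For a reflection [hat] gives an involution, equal to its q-th power; for a product of two,
     [hatM_invol] applies. *)
  rewrite FH multX; case: (dihedral_elem n_gt0 k) => [[i ->]|[i [j ->]]].
    by rewrite PE hatX.
  by rewrite gmulfM !PE -hatM_invol //; exact: rV.
pose FP : {multiplicative _ -> _} := F \o P.
have FPr i : F (P (refl n i)) = refl n i by rewrite PE FH involX // q_odd.
have FP1 : F (P (gen (dihedral_rel n) Dih1)) = gen (dihedral_rel n) Dih1.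
  by rewrite -refl0 FPr.
apply: (@presented_mult_eq _ _ _ FP idfun) => -[] //=.
(* The second generator is recovered from the fixed reflections s_0 = g1 and s_1 = g1 g2. *)
apply: (mulgI (gen (dihedral_rel n) Dih1)).
by rewrite -{1}FP1 -!gmulfM (FPr 1%N).
Qed.

(** * Central extensions and splitting of cocycles *)

Section CentralExtension.
Variables (G : groupType) (M : zmodType) (f : G -> G -> M).
Hypothesis f_cocycle :
  forall g h k, (f h k + f g (h * k) = f (g * h) k + f g h)%R.

(* The cocycle condition is an argument so that the group structure below can be
   attached to the type. *)
Definition extension of (forall g h k,
  (f h k + f g (h * k) = f (g * h) k + f g h)%R) : Type := (M * G)%type.

Local Notation E := (extension f_cocycle).

HB.instance Definition _ := Choice.copy E (M * G)%type.

(* The cocycle is not assumed to be normalized, hence the terms f 1 1. *)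
Definition ext_mul (x y : E) : E := ((x.1 + y.1 + f x.2 y.2)%R, x.2 * y.2).
Definition ext_one : E := ((- f 1 1)%R, 1).
Definition ext_inv (x : E) : E :=
  ((- x.1 - f x.2^-1 x.2 - f 1 1)%R, x.2^-1).

Lemma cocycle1g g : f 1 g = f 1 1.
Proof. by have := f_cocycle 1 1 g; rewrite !mul1g => /addrI. Qed.

Lemma cocycleg1 g : f g 1 = f 1 1.
Proof. by have := f_cocycle g 1 1; rewrite !mulg1 addrC => /addrI ->. Qed.

Lemma cocyclegV g : f g g^-1 = f g^-1 g.
Proof.
have := f_cocycle g g^-1 g; rewrite mulVg mulgV cocycle1g cocycleg1.
by rewrite addrC => /addrI.
Qed.

Lemma ext_mulA : associative ext_mul.
Proof.
move=> [a g] [b h] [c k]; rewrite /ext_mul /= mulgA; congr pair.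
rewrite !addrA -[LHS]addrA f_cocycle (addrC (f _ k)) addrA.
by rewrite (addrAC _ c).
Qed.

Lemma ext_mul1g : left_id ext_one ext_mul.
Proof.
by move=> [a g]; rewrite /ext_mul /= mul1g cocycle1g addrAC addNr add0r.
Qed.

Lemma ext_mulg1 : right_id ext_one ext_mul.
Proof. by move=> [a g]; rewrite /ext_mul /= mulg1 cocycleg1 subrK. Qed.

Lemma ext_mulVg : left_inverse ext_one ext_inv ext_mul.
Proof.
move=> [a g]; rewrite /ext_mul /ext_inv /ext_one /= mulVg; congr pair.
by rewrite (addrAC _ a) (addrAC _ _ (f _ _)) subrK addrAC addNr add0r.
Qed.

Lemma ext_mulgV : right_inverse ext_one ext_inv ext_mul.
Proof.
move=> [a g]; rewrite /ext_mul /ext_inv /ext_one /= mulgV cocyclegV; congr pair.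
by rewrite -(addrA (- a)%R) addNKr addrAC addNr add0r.
Qed.

HB.instance Definition _ :=
  isGroup.Build E ext_mulA ext_mul1g ext_mulg1 ext_mulVg ext_mulgV.

Lemma extM (x y : E) : x * y = ((x.1 + y.1 + f x.2 y.2)%R, x.2 * y.2) :> E.
Proof. by []. Qed.

Lemma ext1 : 1 = ((- f 1 1)%R, 1) :> E.
Proof. by []. Qed.

Lemma snd_ext_is_mult : {morph (snd : E -> G) : x y / x * y}.
Proof. by []. Qed.

Definition ext_proj : {multiplicative E -> G} :=
  HB.pack (snd : E -> G) (isMultiplicative.Build E G (snd : E -> G) snd_ext_is_mult).

Variable q : nat.
Hypotheses (q_odd : odd q) (Mq : forall m : M, (m *+ q)%R = 0%R).

Lemma ext_involE (x : E) : x * x = 1 ->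
  x.1 = (- (f x.2 x.2 + f 1 1) *+ uphalf q)%R.
Proof.
rewrite extM ext1 => -[x1 _].
(* Here [uphalf q] is (q + 1)/2, an inverse of 2 on a group killed by the odd q. *)
have half (m : M) : (m *+ 2 *+ uphalf q)%R = m.
  by rewrite -mulrnA mul2n odd_uphalfK // mulrSr Mq add0r.
by rewrite -[LHS]half mulr2n opprD -x1 addrC addrK. 
Qed.

Definition ext_lift (s : G) : E := ((- (f s s + f 1 1) *+ uphalf q)%R, s).

Lemma ext_lift_invol s : s * s = 1 -> ext_lift s * ext_lift s = 1.
Proof.
move=> s2; rewrite extM ext1 /= s2; congr pair.
rewrite -mulr2n -mulrnA muln2 odd_uphalfK // mulrSr Mq add0r.
by rewrite addrC opprD addNKr.
Qed.

Lemma ext_liftE (x : E) : x * x = 1 -> x = ext_lift x.2.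
Proof. by case: x => m g /ext_involE /= ->. Qed.

Lemma ext_liftJ s t : s * s = 1 -> t * t = 1 ->
  ext_lift s ^ ext_lift t = ext_lift (s ^ t).
Proof.
move=> s2 t2; rewrite [LHS]ext_liftE; last first.
  by apply: involJ; exact: ext_lift_invol.
by congr ext_lift; exact: (gmulfJ (multU ext_proj)).
Qed.

End CentralExtension.

(** The homomorphism [F] extending the involutive lifts is a section of the projection. With b its
    first coordinate, multiplicativity reads b(gh) = b(g) + b(h) + f(g, h). *)
Lemma dihedral_cocycle n q (M : zmodType) (f : dihedral n -> dihedral n -> M) :
    0 < n -> odd q -> (forall m : M, (m *+ q)%R = 0%R) ->
    (forall g h k, (f h k + f g (h * k)%g = f (g * h)%g k + f g h)%R) ->
  exists b : dihedral n -> M, forall g h, (f g h = b (g * h)%g - b h - b g)%R.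
Proof.
move=> n_gt0 q_odd Mq fP.
have [F FE] := dihedral_lift n_gt0 (ext_lift_invol fP q_odd Mq) (ext_liftJ fP q_odd Mq).
pose pF : {multiplicative _ -> _} := ext_proj fP \o F.
have F2 g : (F g).2 = g.
  have Fgen x : (F (gen (dihedral_rel n) x)).2 = gen (dihedral_rel n) x.
    have Fr i : (F (refl n i)).2 = refl n i by rewrite FE.
    have F1 : (F (gen (dihedral_rel n) Dih1)).2 = gen (dihedral_rel n) Dih1.
      by rewrite -refl0 Fr.
    case: x => //; apply: (mulgI (gen (dihedral_rel n) Dih1)).
    rewrite -{1}F1 -[LHS](@gmulfM _ _ pF).
    exact: (Fr 1%N).
  exact: (@presented_mult_eq _ _ _ pF idfun Fgen).
exists (fun g => (F g).1) => g h.
by rewrite (@gmulfM _ _ F) extM !F2 (addrAC _ _ (f g h)) addrK addrAC subrr add0r.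
Qed.

(** * Vanishing of the second homology *)

Import monalg generic_quotient ring_quotient.

Section Boundaries.
Variables (G : groupType) (A : zmodType).

Local Open Scope ring_scope.

Definition bar3_image : {pred {malg A[(G * G)%type]}} :=
  [pred c | `[< exists b, bar3 b = c >]].

Lemma bar3_image_zmod_closed : zmod_closed bar3_image.
Proof.
split=> [|c c' /asboolP[b <-] /asboolP[b' <-]]; apply/asboolP.
  by exists 0; exact: raddf0.
by exists (b - b'); exact: bar3B.
Qed.

HB.instance Definition _ :=
  GRing.isZmodClosed.Build _ bar3_image bar3_image_zmod_closed.

(** The quotient is of all 2-chains, not only of cycles, because a single cell [g|h] need not be a
    cycle. *)
Definition bar_coker : zmodType := Quotient.quot bar3_image.

Definition coker_proj (c : {malg A[(G * G)%type]}) : bar_coker :=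
  (\pi_bar_coker c)%qT.

Lemma coker_projB : zmod_morphism coker_proj.
Proof. exact: pi_is_zmod_morphism. Qed.

HB.instance Definition _ := GRing.isZmodMorphism.Build _ _ coker_proj coker_projB.

Lemma coker_proj_eq0 c : coker_proj c = 0 -> exists b, bar3 b = c.
Proof.
move=> c0; apply/asboolP; change (c \in bar3_image).
rewrite -[c]subr0 Quotient.idealrBE; apply/eqP.
by rewrite [RHS]raddf0.
Qed.

Lemma coker_proj_bar3 b : coker_proj (bar3 b) = 0.
Proof.
rewrite -[RHS](raddf0 coker_proj); apply/eqP.
by rewrite -Quotient.idealrBE subr0; apply/asboolP; exists b.
Qed.

Lemma H2_eq0_coker :
  (forall c, bar2 c = 0 -> coker_proj c = 0) -> forall x : H2 G A, x = 0.
Proof.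
move=> cyc0; elim/quotW => c.
have /coker_proj_eq0 bc : coker_proj c = 0 by apply: cyc0; apply/eqP/cycle2P.
rewrite -[RHS](raddf0 (\pi_(H2 G A))%qT); apply/eqP.
by rewrite -Quotient.idealrBE subr0; apply/asboolP.
Qed.

End Boundaries.

Section Coefficients.
Variables (p : nat) (M : zmodType).
Hypothesis Mp : forall m : M, (m *+ p.+1)%R = 0%R.

Local Open Scope ring_scope.

(** Sums in ['I_p.+1] are reduced modulo p + 1, and the discarded multiple of p + 1 kills [m]. *)
Lemma mulrn_ordB (m : M) (a b : 'I_p.+1) : m *+ (a - b)%R = m *+ a - m *+ b.
Proof.
have D (x y : 'I_p.+1) : m *+ (x + y)%R = m *+ x + m *+ y.
  by rewrite -mulrnDr [in RHS](divn_eq (x + y) p.+1) mulrnDr mulrnA Mp add0r.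
by have := D (a - b) b; rewrite subrK => ->; rewrite addrK.
Qed.

End Coefficients.

Lemma H2_eq0 (G : groupType) (q : nat) : 0 < q ->
    (forall (M : zmodType) (f : G -> G -> M), (forall m : M, (m *+ q)%R = 0%R) ->
      (forall g h k, (f h k + f g (h * k)%g = f (g * h)%g k + f g h)%R) ->
      exists b : G -> M, forall g h, (f g h = b (g * h)%g - b h - b g)%R) ->
  forall x : H2 G (Zmod q), x = 0%R.
Proof.
case: q => // p _ splits; apply: H2_eq0_coker; rewrite /Zmod /=.
move=> c c0.
pose M := bar_coker G 'I_p.+1.
pose pr := @coker_proj G 'I_p.+1.
have ZqE (a : 'I_p.+1) n : (a *+ n)%R = inZp (a * n) by exact: Zp_mulrn.
have Mq (m : M) : (m *+ p.+1)%R = 0%R.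
  elim/quotW: m => d; rewrite -[LHS](raddfMn (@coker_proj G 'I_p.+1)).
  suff -> : (d *+ p.+1)%R = 0%R by exact: raddf0.
  apply/malgP => k; rewrite mcoeffMn mcoeff0 ZqE.
  by apply: val_inj; rewrite /= modnMl.
pose f g h : M := pr << (Zp1 : 'I_p.+1) *g (g, h) >>%R.
have prU a g h : (pr << a *g (g, h) >> = f g h *+ a)%R.
  rewrite -(raddfMn (@coker_proj G 'I_p.+1)) -monalgUMn ZqE; congr (pr << _ *g _ >>%R).
  by apply: val_inj; rewrite /= modnMml mul1n modn_small.
have [|b fb] := splits M f Mq.
  (* The cocycle identity says that the boundary of 1[g|h|k] has trivial class. *)
  move=> g h k; have := coker_proj_bar3 << (Zp1 : 'I_p.+1) *g (g, h, k) >>%R.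
  rewrite bar3U !(raddfB, raddfD) => /eqP; rewrite subr_eq0 => /eqP E.
  rewrite -[f g h]E [in RHS]addrA; congr (_ + _)%R.
  by rewrite addrC subrK.
have [psi psiU] : exists psi : {additive {malg 'I_p.+1[G]} -> M},
    forall a g, (psi << a *g g >> = b g *+ a)%R.
  pose psi := chain_lift (fun (a : 'I_p.+1) g => (b g *+ a)%R).
  have psiB : zmod_morphism psi.
    by apply: chain_liftB => g x y; exact: mulrn_ordB.
  pose psi' : {additive _ -> _} :=
    HB.pack psi (GRing.isZmodMorphism.Build _ _ psi psiB).
  exists psi' => a g.
  exact: chain_liftU.
(* The coboundary formula for [f], extended linearly: the projection factors through [bar2], so it
   vanishes on cycles. *)
have prE d : pr d = (- psi (bar2 d))%R.
  rewrite (monalgE d) /pr (raddf_sum (@coker_proj G 'I_p.+1)).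
  rewrite (raddf_sum (@bar2 G 'I_p.+1)) (raddf_sum psi) -sumrN.
  apply: eq_bigr => -[g h] _ /=.
  rewrite [LHS]prU bar2U raddfD raddfB /= !psiU fb !mulrnBl.
  by rewrite opprD opprB.
by rewrite [LHS]prE c0 raddf0 oppr0.
Qed.

Theorem proposition4p4 (n q : nat) (n_gt0 : (0 < n)%N) (q_odd : odd q) :
  group_iso (qtensor_square q (dihedral n)) (dihedral n) /\
  (forall x : H2 (dihedral n) (Zmod q), x = 0%R).
Proof.
split; first exact: qtensor_dihedral.
apply: H2_eq0 (odd_gt0 q_odd) _ => M f; exact: dihedral_cocycle.
Qed.
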